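(* Let $\mathcal{M}$ be a 6-orbit map whose truncation $\mathrm{Tr}(\mathcal{M})$ is a 6-orbit map. Then one of the following holds. (i) $\mathcal{M}$ and $\mathrm{Tr}(\mathcal{M})$ are both of type $6_{B_p}$; (ii) $\mathcal{M}$ and $\mathrm{Tr}(\mathcal{M})$ are both of type $6_{G_p}$; (iii) $\mathcal{M}$ and $\mathrm{Tr}(\mathcal{M})$ are both of type $6_{H_p}$; (iv) $\mathcal{M}$ is of type $6_{J_p}$ and $\mathrm{Tr}(\mathcal{M})$ is of type $6_{J_d}$; (v) $\mathcal{M}$ is of type $6_{M_{opp}}$ and $\mathrm{Tr}(\mathcal{M})$ is of type $6_{N_{dp}}$; (vi) $\mathcal{M}$ is of type $6_{N_{opp}}$ and $\mathrm{Tr}(\mathcal{M})$ is of type $6_{F_d}$ or of type $6_{M_{dp}}$; (vii) $\mathcal{M}$ is of type $6_{O_{opp}}$ and $\mathrm{Tr}(\mathcal{M})$ is of type $6_{P_{dp}}$; (viii) $\mathcal{M}$ is of type $6_{P_{opp}}$ and $\mathrm{Tr}(\mathcal{M})$ is of type $6_{O_{dp}}$.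
   Context: A map $\mathcal{M}$ is a 2-cell embedding of a connected graph on a surface. Its flags are the triangles of the barycentric subdivision of $\mathcal{M}$, each identified with a triple $(\Phi_0,\Phi_1,\Phi_2)$ of a mutually incident vertex, edge and face; $\mathcal{F}(\mathcal{M})$ is the set of flags. For $i\in\{0,1,2\}$ let $s_i$ be the permutation of $\mathcal{F}(\mathcal{M})$ (acting on the right) sending each flag $\Phi$ to its $i$-adjacent flag $\Phi^{s_i}=\Phi^i$ (the neighbouring triangle differing from $\Phi$ only in the entry $\Phi_i$). The $s_i$ are fixed-point free involutions, $s_0s_2=s_2s_0$ is a fixed-point free involution, and $\langle s_0,s_1,s_2\rangle$ is transitive on $\mathcal{F}(\mathcal{M})$. The automorphism group $\Gamma(\mathcal{M})$ is (identified with) the group of permutations of $\mathcal{F}(\mathcal{M})$ commuting with $s_0,s_1,s_2$; it acts freely on flags. $\mathcal{M}$ is a $k$-orbit map if $\Gamma(\mathcal{M})$ has exactly $k$ orbits on $\mathcal{F}(\mathcal{M})$. The $s_i$ act on the set $\mathrm{Orb}(\mathcal{M})$ of flag-orbits by $\mathcal{O}_\Phi\cdot s_i=\mathcal{O}_{\Phi^{s_i}}$. Symmetry type graph: $T(\mathcal{M})$ has vertex set $\mathrm{Orb}(\mathcal{M})$, with an edge of colour $i$ joining two distinct orbits interchanged by $s_i$, and a semi-edge of colour $i$ at each orbit fixed by $s_i$. A type with $k$ vertices is given below by a triple $(\sigma_0,\sigma_1,\sigma_2)$ of permutations of $\{1,\dots,k\}$ in cycle notation: $\mathcal{M}$ is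 of that type iff there is a bijection $\mathrm{Orb}(\mathcal{M})\to\{1,\dots,k\}$ carrying the action of $s_i$ to $\sigma_i$ for $i=0,1,2$. (For $\mathrm{Tr}(\mathcal{M})$, the involutions $r_i$ below play the role of $s_i$.) Truncation: $\mathrm{Tr}(\mathcal{M})$ is the map on the same surface with flag set $\mathcal{F}(\mathcal{M})\times\{0,1,2\}$ and flag adjacencies $r_0,r_1,r_2$ given by $(\Phi,0)r_0=(\Phi^{s_1},0)$, $(\Phi,0)r_1=(\Phi^{s_2},0)$, $(\Phi,0)r_2=(\Phi,2)$; $(\Phi,1)r_0=(\Phi^{s_0},1)$, $(\Phi,1)r_1=(\Phi,2)$, $(\Phi,1)r_2=(\Phi^{s_2},1)$; $(\Phi,2)r_0=(\Phi^{s_1},2)$, $(\Phi,2)r_1=(\Phi,1)$, $(\Phi,2)r_2=(\Phi,0)$. Types on $\{1,\dots,6\}$: $6_{B_p}$: $\sigma_0=(1\,3)(4\,6)(2\,5)$, $\sigma_1=(1\,4)(2\,3)(5\,6)$, $\sigma_2=(1\,3)(4\,6)(2\,5)$. $6_{G_p}$: $\sigma_0=(1\,6)(3\,4)(2\,5)$, $\sigma_1=(1\,4)(2\,3)(5\,6)$, $\sigma_2=(1\,3)(4\,6)(2\,5)$. $6_{H_p}$: $\sigma_0=(1\,6)(3\,4)$, $\sigma_1=(2\,3)(5\,6)$, $\sigma_2=(1\,3)(4\,6)$. $6_{N_{dp}}$: $\sigma_0=(1\,6)(3\,4)$, $\sigma_1=(1\,4)(2\,3)(5\,6)$, $\sigma_2=(1\,3)(4\,6)(2\,5)$.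 $6_{M_{dp}}$: $\sigma_0=(1\,6)(3\,4)(2\,5)$, $\sigma_1=(2\,3)(5\,6)$, $\sigma_2=(1\,3)(4\,6)$. $6_{O_{dp}}$: $\sigma_0=(1\,3)(4\,6)$, $\sigma_1=(1\,4)(2\,3)(5\,6)$, $\sigma_2=(1\,3)(4\,6)(2\,5)$. $6_{P_{dp}}$: $\sigma_0=(1\,3)(4\,6)(2\,5)$, $\sigma_1=(2\,3)(5\,6)$, $\sigma_2=(1\,3)(4\,6)$. $6_{M_{opp}}$, $6_{N_{opp}}$, $6_{O_{opp}}$, $6_{P_{opp}}$: obtained from $6_{M_{dp}}$, $6_{N_{dp}}$, $6_{O_{dp}}$, $6_{P_{dp}}$, respectively, by interchanging $\sigma_0$ and $\sigma_2$. $6_{F_d}$: $\sigma_0=(3\,4)(1\,5)(2\,6)$, $\sigma_1=(2\,3)(5\,6)$, $\sigma_2=(1\,2)(5\,6)$. $6_{J_d}$: $\sigma_0=(3\,4)(5\,6)$, $\sigma_1=(2\,3)(4\,5)$, $\sigma_2=(1\,2)(5\,6)$. $6_{J_p}$: $\sigma_0=(1\,2)(3\,4)$, $\sigma_1=(2\,3)(4\,5)$, $\sigma_2=(3\,4)(5\,6)$. *)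

(* Defs.v *)
From mathcomp Require Import all_boot all_fingroup.
From mathcomp Require Import boolp classical_sets functions cardinality.
Set Implicit Arguments. Unset Strict Implicit. Unset Printing Implicit Defensive.

(* The canonical element k of 'I_3; used both for colours and for the last
   component of the flags of a truncation. *)
Notation "'# k" := (@Ordinal 3 k isT) (at level 8, k at level 2, format "''#' k").

(* A map, given by its flag graph. [adj M i] is the i-adjacency s_i; since
   permutations act on the right, the word s_i s_j is the function
   [adj M j \o adj M i].  The flag set is an arbitrary type: it may be
   infinite. *)
Record surface_map := SurfaceMap {
  flag : Type;
  adj : 'I_3 -> flag -> flag;
  flag_inhabited : inhabited flag;
  adjK : forall i, involutive (adj i);
  adj_free : forall i x, adj i x <> x;
  adj02C : forall x, adj '#2 (adj '#0 x) = adj '#0 (adj '#2 x);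
  adj02_free : forall x, adj '#2 (adj '#0 x) <> x;
  adj_trans : forall x y,
    exists w : seq 'I_3, foldl (fun z i => adj i z) x w = y
}.

Arguments adj : clear implicits.

Definition automorphism (M : surface_map) (g : flag M -> flag M) : Prop :=
  bijective g /\ forall i x, g (adj M i x) = adj M i (g x).

Definition flag_orbit (M : surface_map) (x : flag M) : set (flag M) :=
  [set y | exists2 g, automorphism g & y = g x]%classic.

Definition Orb (M : surface_map) : set (set (flag M)) :=
  [set O | exists x, O = flag_orbit x]%classic.

Arguments Orb : clear implicits.

Definition orbit_map (k : nat) (M : surface_map) : Prop :=
  (Orb M #= `I_k)%card.

(* [sigma i] is the permutation of the vertices of the symmetry type graph
   that gives the edges and semi-edges of colour i. *)
Definition has_type (k : nat) (sigma : 'I_3 -> 'S_k)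
    (M : surface_map) : Prop :=
  exists f : set (flag M) -> 'I_k,
    set_bij (Orb M) [set: 'I_k]%classic f /\
    forall i x, f (flag_orbit (adj M i x)) = sigma i (f (flag_orbit x)).

Definition tr_adj (M : surface_map) (i : 'I_3) (p : flag M * 'I_3) :
    flag M * 'I_3 :=
  let: (x, j) := p in
  match val j, val i with
  | 0, 0 => (adj M '#1 x, '#0)
  | 0, 1 => (adj M '#2 x, '#0)
  | 0, _ => (x, '#2)
  | 1, 0 => (adj M '#0 x, '#1)
  | 1, 1 => (x, '#2)
  | 1, _ => (adj M '#2 x, '#1)
  | _, 0 => (adj M '#1 x, '#2)
  | _, 1 => (x, '#1)
  | _, _ => (x, '#0)
  end.

Lemma I3P (P : 'I_3 -> Prop) : P '#0 -> P '#1 -> P '#2 -> forall i, P i.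
Proof.
move=> P0 P1 P2 [[|[|[|//]]] lti].
- by rewrite (_ : Ordinal lti = '#0) //; apply: val_inj.
- by rewrite (_ : Ordinal lti = '#1) //; apply: val_inj.
- by rewrite (_ : Ordinal lti = '#2) //; apply: val_inj.
Qed.

Lemma tr_inhabited M : inhabited (flag M * 'I_3).
Proof. by case: (flag_inhabited M) => x; exists; exact: (x, '#0). Qed.

Lemma tr_adjK M i : involutive (@tr_adj M i).
Proof.
by case=> x j; elim/I3P: i; elim/I3P: j => //=; rewrite adjK.
Qed.

Lemma tr_adj_free M i p : @tr_adj M i p <> p.
Proof.
by case: p => x j; elim/I3P: i; elim/I3P: j => //= -[]; exact: adj_free.
Qed.

Lemma tr_adj02C M p :
  @tr_adj M '#2 (tr_adj '#0 p) = tr_adj '#0 (tr_adj '#2 p).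
Proof.
by case: p => x j; elim/I3P: j => //=; rewrite adj02C.
Qed.

Lemma tr_adj02_free M p : @tr_adj M '#2 (tr_adj '#0 p) <> p.
Proof.
by case: p => x j; elim/I3P: j => //= -[]; exact: adj02_free.
Qed.

Lemma tr_adj_trans M p q :
  exists w : seq 'I_3, foldl (fun z i => @tr_adj M i z) p w = q.
Proof.
pose R p q :=
  exists w : seq 'I_3, foldl (fun z i => @tr_adj M i z) p w = q.
have Rtrans a b c : R a b -> R b c -> R a c.
  by move=> [w <-] [w' <-]; exists (w ++ w'); rewrite foldl_cat.
have to0 x j : R (x, j) (x, '#0).
  elim/I3P: j; first by exists [::].
  - by exists [:: '#1; '#2].
  - by exists [:: '#2].
have from0 x j : R (x, '#0) (x, j).
  elim/I3P: j; first by exists [::].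
  - by exists [:: '#2; '#1].
  - by exists [:: '#2].
have step x i : R (x, '#0) (adj M i x, '#0).
  elim/I3P: i.
  - by exists [:: '#2; '#1; '#0; '#1; '#2].
  - by exists [:: '#0].
  - by exists [:: '#1].
have base x w : R (x, '#0) (foldl (fun z i => adj M i z) x w, '#0).
  elim: w x => [|i w IHw] x /=; first by exists [::].
  exact: Rtrans _ _ _ (step x i) (IHw _).
case: p q => [x j] [y l]; have [w <-] := adj_trans x y.
exact: Rtrans _ _ _ (to0 x j) (Rtrans _ _ _ (base x w) (from0 _ l)).
Qed.

Definition truncation (M : surface_map) : surface_map :=
  SurfaceMap (tr_inhabited M) (@tr_adjK M) (@tr_adj_free M) (@tr_adj02C M)
      (@tr_adj02_free M) (@tr_adj_trans M).

(* The label k in {1, ..., 6} is represented by k - 1 : 'I_6; [cyc a b] is the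
   transposition (a b) of labels. *)
Definition cyc (a b : nat) : 'S_6 := tperm (inord a.-1) (inord b.-1).

Definition triple (s0 s1 s2 : 'S_6) : 'I_3 -> 'S_6 :=
  tnth [tuple s0; s1; s2].

(* Interchanges sigma_0 and sigma_2. *)
Definition opp_type (sigma : 'I_3 -> 'S_6) : 'I_3 -> 'S_6 :=
  fun i => sigma (rev_ord i).

Local Open Scope group_scope.

Definition type6_Bp := triple
  (cyc 1 3 * cyc 4 6 * cyc 2 5) (cyc 1 4 * cyc 2 3 * cyc 5 6)
  (cyc 1 3 * cyc 4 6 * cyc 2 5).
Definition type6_Gp := triple
  (cyc 1 6 * cyc 3 4 * cyc 2 5) (cyc 1 4 * cyc 2 3 * cyc 5 6)
  (cyc 1 3 * cyc 4 6 * cyc 2 5).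
Definition type6_Hp := triple
  (cyc 1 6 * cyc 3 4) (cyc 2 3 * cyc 5 6) (cyc 1 3 * cyc 4 6).
Definition type6_Ndp := triple
  (cyc 1 6 * cyc 3 4) (cyc 1 4 * cyc 2 3 * cyc 5 6)
  (cyc 1 3 * cyc 4 6 * cyc 2 5).
Definition type6_Mdp := triple
  (cyc 1 6 * cyc 3 4 * cyc 2 5) (cyc 2 3 * cyc 5 6) (cyc 1 3 * cyc 4 6).
Definition type6_Odp := triple
  (cyc 1 3 * cyc 4 6) (cyc 1 4 * cyc 2 3 * cyc 5 6)
  (cyc 1 3 * cyc 4 6 * cyc 2 5).
Definition type6_Pdp := triple
  (cyc 1 3 * cyc 4 6 * cyc 2 5) (cyc 2 3 * cyc 5 6) (cyc 1 3 * cyc 4 6).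
Definition type6_Mopp := opp_type type6_Mdp.
Definition type6_Nopp := opp_type type6_Ndp.
Definition type6_Oopp := opp_type type6_Odp.
Definition type6_Popp := opp_type type6_Pdp.
Definition type6_Fd := triple
  (cyc 3 4 * cyc 1 5 * cyc 2 6) (cyc 2 3 * cyc 5 6) (cyc 1 2 * cyc 5 6).
Definition type6_Jd := triple
  (cyc 3 4 * cyc 5 6) (cyc 2 3 * cyc 4 5) (cyc 1 2 * cyc 5 6).
Definition type6_Jp := triple
  (cyc 1 2 * cyc 3 4) (cyc 2 3 * cyc 4 5) (cyc 3 4 * cyc 5 6).

(* Main.v *)
Require Import Defs.
From mathcomp Require Import all_boot all_fingroup.
From mathcomp Require Import boolp classical_sets functions cardinality.

(** The layer j of a flag (x, j) of Tr(M) is changed by r_i in a way that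
    depends on j and i only. Hence an automorphism of Tr(M) that keeps the layer
    of one flag keeps the layer of every flag, and it then acts on layer 0 as an
    automorphism of M (lemma [automorphism_untr]); conversely every
    automorphism of M lifts. So two flags of layer 0 are in one orbit of Tr(M)
    exactly when the underlying flags are in one orbit of M
    ([flag_orbit_tr]), and x |-> (x, 0) induces an injection from Orb(M) to
    Orb(Tr(M)). Both sets have six elements, so it is a bijection
    ([labelling_truncation]): both symmetry type graphs live on the same six
    points.

    Let t_0, t_1, t_2 be the action of Tr(M) on these points. On layer 0,
    r_0 is s_1, r_1 is s_2, and the word r_2 r_1 r_0 r_1 r_2 passes through
    layers 2 and 1, where it performs s_0. So M acts by
    (t_2 t_1 t_0 t_1 t_2, t_0, t_1) ([acts_parent]): the type of Tr(M)
    determines that of M. Moreover the vertices of Tr(M) have degree 3, which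
    gives (t_1 t_2)^3 = 1 ([acts_tr_order3]).

    It remains to list, up to conjugation in S_6, the triples of involutions t
    such that t_0 t_2 = t_2 t_0, (t_1 t_2)^3 = 1 and the action of M derived
    from t is transitive. As t_2 can be assumed to be the identity, (1 2),
    (1 2)(3 4) or (1 2)(3 4)(5 6), this is a short enumeration; it finds nine
    classes ([candidates_classified]), and their derived actions of M are the
    ones in the statement ([parent_types]). *)

Set Implicit Arguments. Unset Strict Implicit. Unset Printing Implicit Defensive.
Local Open Scope group_scope.

(** * Automorphisms and flag orbits *)

Lemma automorphism_id M : @automorphism M id.
Proof. by split; first exists id. Qed.

Lemma automorphism_comp M (g h : flag M -> flag M) :
  automorphism g -> automorphism h -> automorphism (g \o h).
Proof.
move=> [gbij gC] [hbij hC]; split; first exact: bij_comp.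
by move=> i x /=; rewrite hC gC.
Qed.

Lemma automorphism_inv M (g : flag M -> flag M) : automorphism g ->
  exists h, [/\ automorphism h, cancel g h & cancel h g].
Proof.
move=> [[h gK hK] gC]; exists h; split=> //; split; first by exists g.
by move=> i x; rewrite -{1}[x]hK -gC gK.
Qed.

Lemma flag_orbit_eqP M (x y : flag M) :
  flag_orbit x = flag_orbit y <-> exists2 g, automorphism g & y = g x.
Proof.
split=> [exy | [g gA ->]].
  have: flag_orbit y y by exists id => //; exact: automorphism_id.
  by rewrite -exy.
have [h [hA gK _]] := automorphism_inv gA.
apply/seteqP; split=> _ [k kA ->].
  by exists (k \o h); [exact: automorphism_comp | rewrite /= gK].
by exists (k \o g) => //; exact: automorphism_comp.
Qed.

Lemma flag_orbit_adj M i (x y : flag M) :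
  flag_orbit (adj M i x) = flag_orbit (adj M i y) <->
  flag_orbit x = flag_orbit y.
Proof.
have adj_orbit a b : flag_orbit a = flag_orbit b ->
    flag_orbit (adj M i a) = flag_orbit (adj M i b).
  case/flag_orbit_eqP=> g gA ->; apply/flag_orbit_eqP; exists g => //.
  by have [_ ->] := gA.
by split=> /adj_orbit; rewrite // !adjK.
Qed.

(** * Automorphisms of a truncation *)

Lemma tr_adj_layer M i (p q : flag M * 'I_3) :
  p.2 = q.2 -> (tr_adj i p).2 = (tr_adj i q).2.
Proof. by case: p q => x j [y l] /= <-; elim/I3P: j; elim/I3P: i. Qed.

(** By [tr_adj_layer] the set of flags whose layer is kept is closed under
    adjacency, and the adjacencies are transitive. *)
Lemma automorphism_layer M (h : flag (truncation M) -> flag (truncation M)) p :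
  automorphism h -> (h p).2 = p.2 -> forall q, (h q).2 = q.2.
Proof.
move=> [_ hC] hp q; have [w <-] := adj_trans p q.
elim: w p hp => //= i w IHw p hp; apply: IHw.
by rewrite hC; exact: tr_adj_layer.
Qed.

Lemma automorphism_tr M (g : flag M -> flag M) : automorphism g ->
  automorphism (fun p : flag (truncation M) => (g p.1, p.2)).
Proof.
move=> [[h gK hK] gC]; split.
  by exists (fun p => (h p.1, p.2)) => -[x j] /=; rewrite ?gK ?hK.
by move=> i [x j]; elim/I3P: i; elim/I3P: j => /=; rewrite ?gC.
Qed.

(** Layer 0 carries s_1 and s_2 as adjacencies; s_0 is an adjacency of layer 1
    only, which is reached from layer 0 through layer 2. *)
Lemma adj_tr M (x : flag M) : let r := adj (truncation M) in
  [/\ (adj M '#0 x, '#0) = r '#2 (r '#1 (r '#0 (r '#1 (r '#2 (x, '#0))))),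
      (adj M '#1 x, '#0) = r '#0 (x, '#0)
    & (adj M '#2 x, '#0) = r '#1 (x, '#0)].
Proof. by []. Qed.

(** An automorphism commutes with the words of [adj_tr]. *)
Lemma automorphism_untr M (h : flag (truncation M) -> flag (truncation M)) :
    automorphism h -> (forall p, (h p).2 = p.2) ->
  automorphism (fun x : flag M => (h (x, '#0)).1).
Proof.
move=> hA h2; have [k [kA hK kK]] := automorphism_inv hA.
have k2 p : (k p).2 = p.2 by rewrite -h2 kK.
have h0 x : h (x, '#0) = ((h (x, '#0)).1, '#0).
  by rewrite -[RHS]/(_, (x, '#0 : 'I_3).2) -h2; case: (h _).
have k0 x : k (x, '#0) = ((k (x, '#0)).1, '#0).
  by rewrite -[RHS]/(_, (x, '#0 : 'I_3).2) -k2; case: (k _).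
split.
  by exists (fun x => (k (x, '#0)).1) => x; rewrite -?k0 -?h0 ?hK ?kK.
have [_ hC] := hA; move=> i x; have [e0 e1 e2] := adj_tr x.
have [f0 f1 f2] := adj_tr (h (x, '#0)).1.
rewrite -[RHS]/((adj M i (h (x, '#0)).1, '#0).1); congr fst.
elim/I3P: i; first by rewrite e0 f0 -h0 !hC.
  by rewrite e1 f1 -h0 !hC.
by rewrite e2 f2 -h0 !hC.
Qed.

Lemma flag_orbit_tr M (x y : flag M) :
  @flag_orbit (truncation M) (x, '#0) =
  @flag_orbit (truncation M) (y, '#0) <->
  flag_orbit x = flag_orbit y.
Proof.
split=> /flag_orbit_eqP[g gA].
  move=> ey; apply/flag_orbit_eqP; exists (fun z => (g (z, '#0)).1).
    apply: automorphism_untr => //.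
    by apply: (@automorphism_layer _ _ (x, '#0) gA); rewrite -ey.
  by rewrite -ey.
move=> ->; apply/flag_orbit_eqP; exists (fun p => (g p.1, p.2)) => //.
exact: automorphism_tr.
Qed.

(** * Labellings of the orbits by numbers *)

(** A bijection from the set of flag orbits to 'I_k, given as a function of
    flags, which avoids functions on sets of flags. *)
Definition labelling M k (l : flag M -> 'I_k) : Prop :=
  (forall o, exists x, l x = o) /\
  (forall x y, l x = l y <-> flag_orbit x = flag_orbit y).

Definition acts k M (l : flag M -> 'I_k) (sigma : 'I_3 -> 'S_k) : Prop :=
  forall i x, l (adj M i x) = sigma i (l x).

Lemma orbit_map_labelling k M :
  orbit_map k M -> exists l : flag M -> 'I_k, labelling l.
Proof.
case/card_set_bijP=> f [f_fun f_inj f_surj].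
have lt_f x : f (flag_orbit x) < k by apply: f_fun; exists x.
have inOrb (x : flag M) : flag_orbit x \in Orb M by rewrite inE; exists x.
exists (fun x => Ordinal (lt_f x)); split.
  move=> o; have [_ [x ->] fx] := f_surj o (ltn_ord o).
  by exists x; apply: val_inj.
move=> x y; split=> [[] /f_inj-> //|exy]; apply: val_inj => /=.
by rewrite exy.
Qed.

(** Any function that separates exactly the orbits is a labelling up to a
    permutation: an injection of 'I_k into itself is onto. *)
Lemma labelling_perm k M (l h : flag M -> 'I_k) : labelling l ->
    (forall x y, h x = h y <-> flag_orbit x = flag_orbit y) ->
  exists s : 'S_k, forall x, h x = s (l x).
Proof.
move=> [l_surj lP] hP; have [c cK] := choice l_surj.
have inj_hc : injective (h \o c).
  by move=> i j /= /hP/lP; rewrite !cK.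
by exists (perm inj_hc) => x; rewrite permE; apply/hP/lP; rewrite cK.
Qed.

Lemma labelling_acts k M (l : flag M -> 'I_k) :
  labelling l -> exists sigma, acts l sigma.
Proof.
move=> lL; suff /choice[sigma sigmaE]: forall i, exists s : 'S_k,
    forall x, l (adj M i x) = s (l x) by exists sigma.
move=> i; apply: labelling_perm => // x y.
exact: iff_trans (lL.2 _ _) (flag_orbit_adj i x y).
Qed.

Lemma labelling_relabel k M (l : flag M -> 'I_k) (p : 'S_k) :
  labelling l -> labelling (p \o l).
Proof.
move=> [l_surj lP]; split=> [o | x y].
  by have [x lx] := l_surj (p^-1 o); exists x; rewrite /= lx permKV.
by rewrite -lP; split=> [/perm_inj | /= ->].
Qed.

Lemma acts_relabel k M (l : flag M -> 'I_k) sigma tau p :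
    acts l sigma -> (forall i, tau i = sigma i ^ p) -> acts (p \o l) tau.
Proof. by move=> lA tauE i x; rewrite tauE permJ /= lA. Qed.

Lemma labelling_type k M (l : flag M -> 'I_k) sigma :
  labelling l -> acts l sigma -> has_type sigma M.
Proof.
move=> [l_surj lP] lA; have [x0] := flag_inhabited M.
have [O|f fP] := @choice _ _ (fun (O : set (flag M)) o =>
    forall x, O = flag_orbit x -> o = l x).
  have [[x ->] | nO] := pselect (exists x, O = flag_orbit x).
    by exists (l x) => y /lP.
  (* Sets that are not orbits get the arbitrary label l x0. *)
  by exists (l x0) => x eO; case: nO; exists x.
have fl x : f (flag_orbit x) = l x by exact: fP.
exists f; split; last by move=> i x; rewrite !fl lA.
split=> [//|_ _ /set_mem[x ->] /set_mem[y ->]|o _].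
  by rewrite !fl => /lP.
by have [x <-] := l_surj o; exists (flag_orbit x); [exists x | exact: fl].
Qed.

Lemma acts_involutive k M (l : flag M -> 'I_k) sigma i :
  labelling l -> acts l sigma -> sigma i * sigma i = 1.
Proof.
move=> [l_surj _] lA; apply/permP => o; have [x <-] := l_surj o.
by rewrite permM perm1 -!lA adjK.
Qed.

Lemma acts_02C k M (l : flag M -> 'I_k) sigma :
  labelling l -> acts l sigma -> sigma '#0 * sigma '#2 = sigma '#2 * sigma '#0.
Proof.
move=> [l_surj _] lA; apply/permP => o; have [x <-] := l_surj o.
by rewrite !permM -!lA adj02C.
Qed.

Lemma acts_transitive k M (l : flag M -> 'I_k) sigma (A : pred 'I_k) :
    labelling l -> acts l sigma -> (forall i o, A o -> A (sigma i o)) ->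
  forall o o', A o -> A o'.
Proof.
move=> [l_surj _] lA sA o o'; have [x <-] := l_surj o; have [y <-] := l_surj o'.
have [w <-] := adj_trans x y; elim: w x => //= i w IHw x Ax; apply: IHw.
by rewrite lA; exact: sA.
Qed.

(** * The action of the map from the action of its truncation *)

(** The action of M on the six orbits when that of Tr(M) is t, as read off from
    [adj_tr]. *)
Definition parent (t : 'I_3 -> 'S_6) : 'I_3 -> 'S_6 :=
  triple (t '#2 * t '#1 * t '#0 * t '#1 * t '#2) (t '#0) (t '#1).

Lemma parentE t :
  [/\ parent t '#0 = t '#2 * t '#1 * t '#0 * t '#1 * t '#2,
      parent t '#1 = t '#0 & parent t '#2 = t '#1].
Proof. by split; rewrite /parent /triple (tnth_nth 1). Qed.

(** Layer 0 meets every orbit of Tr(M): it meets as many orbits as M has, by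
    [flag_orbit_tr], which is all of them. *)
Lemma labelling_truncation k M (l : flag (truncation M) -> 'I_k) :
    orbit_map k M -> labelling l ->
  labelling (fun x : flag M => l (x, '#0)).
Proof.
move=> /orbit_map_labelling[l1 l1L] [_ lP].
have l0P (x y : flag M) :
    l (x, '#0) = l (y, '#0) <-> flag_orbit x = flag_orbit y.
  by rewrite lP; exact: flag_orbit_tr.
split=> // o; have [s sE] := labelling_perm l1L l0P.
by have [x l1x] := l1L.1 (s^-1 o); exists x; rewrite sE l1x permKV.
Qed.

Lemma acts_parent M (l : flag (truncation M) -> 'I_6) t :
  acts l t -> acts (fun x : flag M => l (x, '#0)) (parent t).
Proof.
move=> lA i x; have [e0 e1 e2] := adj_tr x; have [p0 p1 p2] := parentE t.
elim/I3P: i; [rewrite e0 p0 | rewrite e1 p1 | rewrite e2 p2].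
- by rewrite !permM -!lA.
- exact: lA.
- exact: lA.
Qed.

(** The relation holds on Tr(M) itself, whose vertices have degree 3. It is
    checked on layer 0, which meets every orbit. *)
Lemma acts_tr_order3 k M (l : flag (truncation M) -> 'I_k) t :
    labelling (fun x : flag M => l (x, '#0)) -> acts l t ->
  let u := t '#1 * t '#2 in u * (u * u) = 1.
Proof.
move=> [l_surj _] lA; apply/permP => o; have [x <-] := l_surj o.
by rewrite !permM perm1 -!lA /= adjK.
Qed.

(** * Permutations of six points as tables *)

(** Permutations do not compute; the enumeration is done on their lists of
    values. *)
Definition table (s : 'S_6) : seq nat := [seq val (s i) | i <- enum 'I_6].

Definition comp (u v : seq nat) : seq nat := [seq nth 0 v k | k <- u].

Definition tables6 : seq (seq nat) := permutations (iota 0 6).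

Lemma nth_table s (i : 'I_6) : nth 0 (table s) i = s i.
Proof.
rewrite (nth_map ord0) ?size_enum_ord ?ltn_ord //.
by congr (val (s _)); apply: val_inj; rewrite /= nth_enum_ord ?ltn_ord.
Qed.

Lemma table_inj : injective table.
Proof.
by move=> s t est; apply/permP => i; apply: ord_inj; rewrite -!nth_table est.
Qed.

Lemma tableM s t : table (s * t) = comp (table s) (table t).
Proof.
rewrite /comp -map_comp; apply: eq_map => i; rewrite permM.
exact: esym (nth_table t (s i)).
Qed.

Lemma table1 : table 1 = iota 0 6.
Proof. by rewrite -val_enum_ord; apply: eq_map => i; rewrite perm1. Qed.

Lemma table_cyc a b : a.-1 < 6 -> b.-1 < 6 ->
  table (cyc a b) =
    [seq if k == a.-1 then b.-1 else if k == b.-1 then a.-1 else k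
      | k <- iota 0 6].
Proof.
move=> lta ltb; rewrite -val_enum_ord -map_comp; apply: eq_map => i /=.
rewrite permE /= -!val_eqE /= !inordK //.
by case: ifP => _; [rewrite inordK | case: ifP => _; rewrite ?inordK].
Qed.

Lemma mem_tables6 s : table s \in tables6.
Proof.
rewrite mem_permutations -val_enum_ord /table [map _ _](map_comp val s).
apply: perm_map; apply: uniq_perm; rewrite ?enum_uniq //.
  by rewrite map_inj_uniq ?enum_uniq //; exact: perm_inj.
by move=> i; rewrite mem_enum -[i](permKV s) map_f ?mem_enum.
Qed.

Lemma tables6P u : u \in tables6 -> exists s, table s = u.
Proof.
rewrite mem_permutations => perm_u.
have size_u : size u = 6 by rewrite (perm_size perm_u) size_iota.
have lt_u (i : 'I_6) : nth 0 u i < 6.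
  have: nth 0 u i \in u by rewrite mem_nth ?size_u.
  by rewrite (perm_mem perm_u) mem_iota.
have inj_u : injective (fun i : 'I_6 => Ordinal (lt_u i)).
  move=> i j [] /eqP; rewrite nth_uniq ?size_u //; first by move/eqP/val_inj.
  by rewrite (perm_uniq perm_u) iota_uniq.
exists (perm inj_u); apply: (@eq_from_nth _ 0).
  by rewrite size_map size_enum_ord size_u.
move=> k; rewrite size_map size_enum_ord => ltk6.
by rewrite (nth_table _ (Ordinal ltk6)) permE.
Qed.

Definition tables (sigma : 'I_3 -> 'S_6) : seq (seq nat) :=
  [:: table (sigma '#0); table (sigma '#1); table (sigma '#2)].

Lemma tables_triple s0 s1 s2 :
  tables (triple s0 s1 s2) = [:: table s0; table s1; table s2].
Proof. by rewrite /tables /triple !(tnth_nth s0). Qed.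

Lemma tables_opp sigma : tables (opp_type sigma) = rev (tables sigma).
Proof.
have ord_eq (i j : 'I_3) : i = j :> nat -> table (sigma i) = table (sigma j).
  by move/ord_inj->.
by congr [:: _; _; _]; apply: ord_eq.
Qed.

Definition parent_tables (ts : seq (seq nat)) : seq (seq nat) :=
  if ts is [:: a; b; c]
  then [:: comp (comp (comp (comp c b) a) b) c; a; b] else [::].

Lemma tables_parent t : tables (parent t) = parent_tables (tables t).
Proof. by rewrite tables_triple !tableM. Qed.

(** Turns the tables of an explicit type into closed terms that compute. *)
Definition tablesE :=
  (tables_parent, tables_opp, tables_triple, tableM, table_cyc).

(** * Conjugate triples *)

Definition conjugate (sigma tau : 'I_3 -> 'S_6) : Prop :=
  exists p : 'S_6, forall i, tau i = sigma i ^ p.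

Definition conj_tables (us vs : seq (seq nat)) : bool :=
  has (fun p => all2 (fun u v => comp u p == comp p v) us vs) tables6.

Lemma conj_tablesP sigma tau :
  conj_tables (tables sigma) (tables tau) -> conjugate sigma tau.
Proof.
case/hasP => _ /tables6P[p <-] /= /and4P[/eqP e0 /eqP e1 /eqP e2 _].
exists p => i; apply: (mulgI p); rewrite -conjgC; apply: table_inj.
by elim/I3P: i; rewrite !tableM.
Qed.

Lemma parent_conjugate s t : conjugate s t -> conjugate (parent s) (parent t).
Proof.
move=> [p tE]; exists p.
have [s0 s1 s2] := parentE s; have [t0 t1 t2] := parentE t.
elim/I3P; rewrite ?(s0, s1, s2, t0, t1, t2) //.
by rewrite !tE -!conjMg.
Qed.

Lemma conjugate_type M (l : flag M -> 'I_6) sigma tau :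
  labelling l -> acts l sigma -> conjugate sigma tau -> has_type tau M.
Proof.
move=> lL lA [p sp].
exact: labelling_type (labelling_relabel p lL) (acts_relabel lA sp).
Qed.

(** * Enumeration of the actions of a truncation *)

Definition involutions : seq (seq nat) :=
  [seq u <- tables6 | comp u u == iota 0 6].

Lemma mem_involutions s : s * s = 1 -> table s \in involutions.
Proof. by move=> ss; rewrite mem_filter -tableM ss table1 eqxx mem_tables6. Qed.

Definition normal_involutions : seq (seq nat) :=
  [:: iota 0 6; [:: 1; 0; 2; 3; 4; 5]; [:: 1; 0; 3; 2; 4; 5];
      [:: 1; 0; 3; 2; 5; 4]]%N.

Lemma involutions_normal :
  all (fun u => has (fun v => conj_tables [:: u] [:: v]) normal_involutions)
    involutions.
Proof. by vm_compute. Qed.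

Lemma normal_involution_exists (s : 'S_6) :
  s * s = 1 -> exists p, table (s ^ p) \in normal_involutions.
Proof.
move=> /mem_involutions/(allP involutions_normal)/hasP[v v_normal].
have /tables6P[d dv]: v \in tables6.
  have /allP: all [in tables6] normal_involutions by vm_compute.
  exact.
rewrite -dv in v_normal *.
case/hasP=> _ /tables6P[p <-] /= /andP[/eqP sp _]; exists p.
suff ->: s ^ p = d by [].
by apply: (mulgI p); rewrite -conjgC; apply: table_inj; rewrite !tableM.
Qed.

(** The points at distance at most 5 from 0. For involutions, looking for k such
    that u maps k into A is the same as adding the images of A. *)
Definition reached (us : seq (seq nat)) : seq nat :=
  iter 5 (fun A => [seq k <- iota 0 6 |
    (k \in A) || has (fun u => nth 0 u k \in A) us]) [:: 0].

(** That A is invariant is part of the test, so that a positive answer refutes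
    transitivity whatever [reached] computes. *)
Definition proper_invariant (us : seq (seq nat)) (A : seq nat) : bool :=
  [&& 0 \in A, all (fun u => all (fun k => nth 0 u k \in A) A) us
    & ~~ all (fun k => k \in A) (iota 0 6)].

Definition intransitive (us : seq (seq nat)) : bool :=
  proper_invariant us (reached us).

Lemma acts_not_proper_invariant M (l : flag M -> 'I_6) sigma A :
  labelling l -> acts l sigma -> ~~ proper_invariant (tables sigma) A.
Proof.
move=> lL lA; apply/negP => /and3P[A0 /allP A_inv /negP[]].
apply/allP => k; rewrite mem_iota => ltk6.
apply: (@acts_transitive _ _ _ _ (fun o => val o \in A) lL lA _
  ord0 (Ordinal ltk6)) => // i o Ao.
have s_i : table (sigma i) \in tables sigma.
  by elim/I3P: i; rewrite !inE eqxx ?orbT.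
by have /allP/(_ _ Ao) := A_inv _ s_i; rewrite nth_table.
Qed.

(** The triples with last entry c that satisfy what is known of the action of a
    truncation: [acts_involutive], [acts_02C], [acts_tr_order3], and the
    transitivity of the derived action of M. *)
Definition candidates (c : seq nat) : seq (seq (seq nat)) :=
  [seq ts <- [seq [:: a; b; c] |
      b <- [seq b <- involutions |
              comp (comp b c) (comp (comp b c) (comp b c)) == iota 0 6],
      a <- [seq a <- involutions | comp a c == comp c a]]
    | ~~ intransitive (parent_tables ts)].

Lemma mem_candidates (t : 'I_3 -> 'S_6) : (forall i, t i * t i = 1) ->
    t '#0 * t '#2 = t '#2 * t '#0 ->
    (let u := t '#1 * t '#2 in u * (u * u) = 1) ->
    ~~ intransitive (tables (parent t)) ->
  tables t \in candidates (table (t '#2)).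
Proof.
move=> tt t02 t12 t_trans; rewrite mem_filter -tables_parent t_trans.
apply: (allpairs_f (fun b a => [:: a; b; table (t '#2)])).
  by rewrite mem_filter -!tableM t12 table1 eqxx mem_involutions ?tt.
by rewrite mem_filter -!tableM t02 eqxx mem_involutions ?tt.
Qed.

Definition truncated_types : seq ('I_3 -> 'S_6) :=
  [:: type6_Bp; type6_Gp; type6_Hp; type6_Jd; type6_Ndp; type6_Fd; type6_Mdp;
      type6_Pdp; type6_Odp].

Definition truncated_tables : seq (seq (seq nat)) :=
  [:: [:: [:: 2; 4; 0; 5; 1; 3]; [:: 3; 2; 1; 0; 5; 4]; [:: 2; 4; 0; 5; 1; 3]];
      [:: [:: 5; 4; 3; 2; 1; 0]; [:: 3; 2; 1; 0; 5; 4]; [:: 2; 4; 0; 5; 1; 3]];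
      [:: [:: 5; 1; 3; 2; 4; 0]; [:: 0; 2; 1; 3; 5; 4]; [:: 2; 1; 0; 5; 4; 3]];
      [:: [:: 0; 1; 3; 2; 5; 4]; [:: 0; 2; 1; 4; 3; 5]; [:: 1; 0; 2; 3; 5; 4]];
      [:: [:: 5; 1; 3; 2; 4; 0]; [:: 3; 2; 1; 0; 5; 4]; [:: 2; 4; 0; 5; 1; 3]];
      [:: [:: 4; 5; 3; 2; 0; 1]; [:: 0; 2; 1; 3; 5; 4]; [:: 1; 0; 2; 3; 5; 4]];
      [:: [:: 5; 4; 3; 2; 1; 0]; [:: 0; 2; 1; 3; 5; 4]; [:: 2; 1; 0; 5; 4; 3]];
      [:: [:: 2; 4; 0; 5; 1; 3]; [:: 0; 2; 1; 3; 5; 4]; [:: 2; 1; 0; 5; 4; 3]];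
      [:: [:: 2; 1; 0; 5; 4; 3]; [:: 3; 2; 1; 0; 5; 4]; [:: 2; 4; 0; 5; 1; 3]]]%N.

Lemma tables_truncated :
  [seq tables tau | tau <- truncated_types] = truncated_tables.
Proof. by rewrite /= !tablesE. Qed.

(** An exhaustive search. [truncated_tables] stands for the tables of
    [truncated_types], which do not reduce. *)
Lemma candidates_classified :
  all (fun ts => has (conj_tables ts) truncated_tables)
    (flatten [seq candidates c | c <- normal_involutions]).
Proof. by vm_compute. Qed.

Lemma truncation_classified (t : 'I_3 -> 'S_6) : (forall i, t i * t i = 1) ->
    t '#0 * t '#2 = t '#2 * t '#0 ->
    (let u := t '#1 * t '#2 in u * (u * u) = 1) ->
    ~~ intransitive (tables (parent t)) ->
    table (t '#2) \in normal_involutions ->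
  has (fun tau => conj_tables (tables t) (tables tau)) truncated_types.
Proof.
move=> tt t02 t12 t_trans t_normal.
have /(allP candidates_classified) :
    tables t \in flatten [seq candidates c | c <- normal_involutions].
  by apply/flatten_mapP; exists (table (t '#2)) => //; exact: mem_candidates.
by rewrite -tables_truncated has_map.
Qed.

Lemma parent_types :
  [/\ conjugate (parent type6_Bp) type6_Bp,
      conjugate (parent type6_Gp) type6_Gp,
      conjugate (parent type6_Hp) type6_Hp,
      conjugate (parent type6_Jd) type6_Jp
    & conjugate (parent type6_Ndp) type6_Mopp] /\
  [/\ conjugate (parent type6_Fd) type6_Nopp,
      conjugate (parent type6_Mdp) type6_Nopp,
      conjugate (parent type6_Pdp) type6_Oopp
    & conjugate (parent type6_Odp) type6_Popp].
Proof. by do 2!split; apply: conj_tablesP; rewrite !tablesE. Qed.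

(** * The pairs of types *)

Lemma type_via_truncation M (l : flag (truncation M) -> 'I_6) t tau mu :
    labelling l -> labelling (fun x : flag M => l (x, '#0)) -> acts l t ->
    conjugate (parent tau) mu -> conjugate t tau ->
  has_type mu M /\ has_type tau (truncation M).
Proof.
move=> lL l0L lA tau_mu t_tau; split; last exact: conjugate_type lL lA t_tau.
have [p tp] := parent_conjugate t_tau.
exact: conjugate_type (labelling_relabel p l0L)
  (acts_relabel (acts_parent lA) tp) tau_mu.
Qed.

Theorem proposition8 (M : surface_map) (hM : orbit_map 6 M)
    (hTr : orbit_map 6 (truncation M)) :
  (has_type type6_Bp M /\ has_type type6_Bp (truncation M)) \/
  (has_type type6_Gp M /\ has_type type6_Gp (truncation M)) \/
  (has_type type6_Hp M /\ has_type type6_Hp (truncation M)) \/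
  (has_type type6_Jp M /\ has_type type6_Jd (truncation M)) \/
  (has_type type6_Mopp M /\ has_type type6_Ndp (truncation M)) \/
  (has_type type6_Nopp M /\
    (has_type type6_Fd (truncation M) \/ has_type type6_Mdp (truncation M))) \/
  (has_type type6_Oopp M /\ has_type type6_Pdp (truncation M)) \/
  (has_type type6_Popp M /\ has_type type6_Odp (truncation M)).
Proof.
have [l1 l1L] := orbit_map_labelling hTr.
have [t1 l1A] := labelling_acts l1L.
(* The enumeration covers only normal forms of t_2, hence the relabelling. *)
have [p t2_normal] := normal_involution_exists (acts_involutive '#2 l1L l1A).
have lL := labelling_relabel p l1L.
have lA : acts (p \o l1) (fun i => t1 i ^ p) by exact: acts_relabel l1A _.
have l0L := labelling_truncation hM lL.
have := truncation_classified (fun i => acts_involutive i lL lA)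
  (acts_02C lL lA) (acts_tr_order3 l0L lA)
  (acts_not_proper_invariant _ l0L (acts_parent lA)) t2_normal.
have [[Bp Gp Hp Jd Ndp] [Fd Mdp Pdp Odp]] := parent_types.
have typed := type_via_truncation lL l0L lA.
case/or4P=> [|||/or4P[|||/or3P[||/orP[|//]]]] /conj_tablesP t_tau.
- by left; exact: typed Bp t_tau.
- by right; left; exact: typed Gp t_tau.
- by do 2!right; left; exact: typed Hp t_tau.
- by do 3!right; left; exact: typed Jd t_tau.
- by do 4!right; left; exact: typed Ndp t_tau.
- by have [? ?] := typed _ _ Fd t_tau; do 5!right; left; split=> //; left.
- by have [? ?] := typed _ _ Mdp t_tau; do 5!right; left; split=> //; right.
- by do 6!right; left; exact: typed Pdp t_tau.
- by do 7!right; exact: typed Odp t_tau.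
Qed.
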